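(* Let $\mathbf{a}$ be a knot sequence in an interval $J\subset\mathbb{R}$ and, for a fixed $\kappa\in\{1,2,3\}$, let $V^k:=S(\Omega^{3k+\kappa}_{\mathbf{a}})$, $k=0,1,2,\ldots$. Then $V^k\subset V^{k+1}$ for all $k\geq 0$, and $\bigcup_{k=0}^{\infty}V^k$ is dense in $L^2(J)$.
   Context: A knot sequence in an interval $J\subset\mathbb{R}$ is a set $\mathbf{a}\subset J$ with at least three elements, having no cluster point in $J$, and with $\inf\mathbf{a}=\inf J$, $\sup\mathbf{a}=\sup J$. For $a\in\mathbf{a}$, $a_+$ and $a_-$ denote the successor and predecessor of $a$ in $\mathbf{a}$ (with $a_+=\infty$ if $a=\sup J$, $a_-=-\infty$ if $a=\inf J$). For a locally finite collection $\Omega\subset L^2(J)$, $S(\Omega):=\operatorname{clos}_{L^2(J)}\operatorname{span}(\Omega)$. For a finite set $A$ of functions, $P_A$ is the orthogonal projection onto $\operatorname{span}A$. Construction of $\Omega^n_{\mathbf{a}}$, $n\ge 1$. Let $p_i^{5/2}$ be the monic ultraspherical (Gegenbauer) polynomial of degree $i$ with parameter $5/2$ (orthogonal on $[-1,1]$ with weight $(1-x^2)^2$). For $i\ge 2$ let $\tilde\phi^i(x)=x(1-x)\,p_{i-2}^{5/2}(2x-1)\,\chi_{[0,1)}(x)$. Let $r(x)=x\chi_{[0,1)}(x)$, $l(x)=(1-x)\chi_{[0,1)}(x)$. Let $$\alpha_n=-\frac{n+1}{2n+5}+\frac{n+3}{2n+5}\sqrt{\frac{3(n+1)(n+3)}{(2n+7)(2n+3)}},\qquad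 z^n=\alpha_n\tilde\phi^{n+1}+\tilde\phi^{n+3},$$ and (with orthogonal projections in $L^2([0,1])$) $$r^n=(I-P_{\{\tilde\phi^2,\ldots,\tilde\phi^n,z^n\}})r,\qquad l^n=(I-P_{\{\tilde\phi^2,\ldots,\tilde\phi^n,z^n\}})l,$$ where the list $\tilde\phi^2,\ldots,\tilde\phi^n$ is empty if $n=1$. For $a\in\mathbf{a}$, $a<\sup J$, let $\sigma_a$ be the affine function with $\sigma_a(a)=0$, $\sigma_a(a_+)=1$, and set $\tilde\phi^i_a=\tilde\phi^i\circ\sigma_a$, $z^n_a=z^n\circ\sigma_a$, $r^n_a=r^n\circ\sigma_a$, $l^n_a=l^n\circ\sigma_a$. For $a<\sup J$ let $\breve\Omega^n_a=\{z^n_a,\tilde\phi^2_a,\ldots,\tilde\phi^n_a\}$ if $\inf J<a<a_+<\sup J$; $\breve\Omega^n_a=\{l^n_a,z^n_a,\tilde\phi^2_a,\ldots,\tilde\phi^n_a\}$ if $a=\inf J$; $\breve\Omega^n_a=\{r^n_a,z^n_a,\tilde\phi^2_a,\ldots,\tilde\phi^n_a\}$ if $a_+=\sup J$. For $\inf J<a<\sup J$ let $\bar\Omega^n_a=\{r^n_{a_-}+l^n_a\}$. Then $\Omega^n_{\mathbf{a}}$ is the union of all the sets $\breve\Omega^n_a$ and $\bar\Omega^n_a$. *)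

(* Defs.v *)
From HB Require Import structures.
From mathcomp Require Import all_boot all_order all_algebra.
From mathcomp Require Import all_classical all_reals all_analysis.
Import Order.TTheory GRing.Theory Num.Theory.
Import numFieldNormedType.Exports.

Set Implicit Arguments.
Unset Strict Implicit.
Unset Printing Implicit Defensive.

Local Open Scope classical_set_scope.
Local Open Scope ring_scope.

Section L2.
Context {R : realType}.
Implicit Types (J : set R) (f g h : R -> R) (A : set (R -> R)).

Definition lspan A : set (R -> R) :=
  [set g | exists (m : nat) (c : 'I_m -> R) (h : 'I_m -> R -> R),
     (forall i, A (h i)) /\ g = (fun x => \sum_(i < m) c i * h i x)].

(* Elements of L^2(J) are handled through representatives R -> R, of which
   only the restriction to J matters. *)
Definition L2 J : set (R -> R) :=
  [set f | f \_ J \in Lfun (@lebesgue_measure R) 2%:E].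

Definition L2norm J f : \bar R :=
  'N[@lebesgue_measure R]_2%:E[EFin \o (f \_ J)].

(* Closure in L^2(J) of A, a set of elements of L^2(J); as a set of representatives it is saturated for
   equality almost everywhere on J. *)
Definition L2closure J A : set (R -> R) :=
  [set f | L2 J f /\
     forall e : R, 0 < e -> exists2 g, A g & (L2norm J (f \- g)%R < e%:E)%E].

Definition L2dense J A := L2 J `<=` L2closure J A.

Definition closed_span J A : set (R -> R) := L2closure J (lspan A).

Definition inner01 f g : R :=
  \int[@lebesgue_measure R]_(x in `[0, 1]) (f x * g x).

(* The projection is determined almost everywhere on [0, 1]; when, as below,
   A consists of linear combinations of the functions phi i, it is a unique
   function. *)
Definition proj01 A f : R -> R :=
  xget (cst 0) [set g | lspan A g /\
    forall h, lspan A h -> inner01 (f \- g) h = 0].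

End L2.

Section generators.
Context {R : realType}.

(* Monic ultraspherical polynomial with parameter 5/2, that is, for the
   weight (1 - x ^ 2) ^ (5/2 - 1/2) on [-1, 1]. *)
Definition is_ultraspherical (i : nat) (p : {poly R}) :=
  [/\ p \is monic, size p = i.+1 &
    forall q : {poly R}, (size q <= i)%N ->
      \int[@lebesgue_measure R]_(x in `[-1, 1])
        (p.[x] * q.[x] * (1 - x ^+ 2) ^+ 2) = 0].

(* Existence and uniqueness being standard, the default value of xget is
   never used. *)
Definition ultraspherical (i : nat) : {poly R} :=
  xget 'X^i [set p | is_ultraspherical i p].

Local Notation chi := (\1_(`[0, 1[%classic) : R -> R).

(* Only meant for 2 <= i. *)
Definition phi (i : nat) (x : R) : R :=
  x * (1 - x) * (ultraspherical (i - 2)).[2 * x - 1] * chi x.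

Definition ramp_r (x : R) : R := x * chi x.
Definition ramp_l (x : R) : R := (1 - x) * chi x.

Definition alpha (n : nat) : R :=
  - ((n%:R + 1) / (2 * n%:R + 5)) +
  (n%:R + 3) / (2 * n%:R + 5) *
  Num.sqrt (3 * (n%:R + 1) * (n%:R + 3) /
            ((2 * n%:R + 7) * (2 * n%:R + 3))).

Definition zfun (n : nat) (x : R) : R :=
  alpha n * phi n.+1 x + phi (n + 3) x.

Definition inner_gens (n : nat) : set (R -> R) :=
  zfun n |` [set phi i | i in [set i | (2 <= i <= n)%N]].

Definition rfun (n : nat) : R -> R := ramp_r \- proj01 (inner_gens n) ramp_r.
Definition lfun (n : nat) : R -> R := ramp_l \- proj01 (inner_gens n) ramp_l.

End generators.

Section knots.
Context {R : realType}.
Implicit Types (J a : set R) (x : R) (f : R -> R) (n : nat).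

Definition einf J : \bar R := ereal_inf (EFin @` J).
Definition esup J : \bar R := ereal_sup (EFin @` J).

Definition knot_sequence J a :=
  [/\ a `<=` J, (`I_3 #<= a)%card, (forall x, J x -> ~ limit_point a x),
      einf a = einf J & esup a = esup J].

(* The values +oo and -oo are taken at the last and first knot, if any; every
   other element of a knot sequence has a neighbour, since knots do not
   accumulate in J. *)
Definition knot_succ a x : \bar R :=
  xget +oo%E (EFin @` [set y | [/\ a y, x < y &
    forall w, a w -> x < w -> y <= w]]).

Definition knot_pred a x : \bar R :=
  xget -oo%E (EFin @` [set y | [/\ a y, y < x &
    forall w, a w -> w < x -> w <= y]]).

(* Composition with the affine map sending x to 0 and the (finite) successor
   of x to 1. *)
Definition transport a x f : R -> R :=
  fun t => f ((t - x) / (fine (knot_succ a x) - x)).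

Definition Omega_breve J a n x : set (R -> R) :=
  let common := transport a x @` inner_gens n in
  if x%:E == einf J then transport a x (lfun n) |` common
  else if knot_succ a x == esup J then transport a x (rfun n) |` common
  else common.

Definition Omega_bar a n x : set (R -> R) :=
  [set transport a (fine (knot_pred a x)) (rfun n) \+ transport a x (lfun n)].

Definition Omega J a n : set (R -> R) :=
  (\bigcup_(x in [set x | a x /\ (x%:E < esup J)%E]) Omega_breve J a n x) `|`
  (\bigcup_(x in [set x | a x /\ (einf J < x%:E < esup J)%E]) Omega_bar a n x).

End knots.

(* Main.v *)
(* Nestedness is algebraic: each rfun n and lfun n differs from the ramp by an
   element of the span of inner_gens n, and inner_gens n lies in the span of
   inner_gens (n + 3), so the generators of level n are combinations of those of
   level n + 3; neither orthogonality nor the value of alpha n matters.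
   For density only the bubbles phi i are needed. The ultraspherical polynomials
   have all degrees, so on each cell the bubbles span all polynomials vanishing at
   both endpoints. The Bernstein polynomials of the indicator of an interval
   inside the cell are of this kind and converge boundedly almost everywhere, so
   the L^2-closure contains the indicators of intervals, then those of measurable
   subsets of the cell by the pi-lambda theorem, then every L^2 function supported
   in one cell. The cells are countably many and cover J up to its endpoints. *)
Require Import Defs.
From mathcomp Require Import all_boot all_order all_algebra.
From mathcomp Require Import all_classical all_reals all_analysis.
From mathcomp Require Import measurable_realfun ring lra.
Import Order.TTheory GRing.Theory Num.Theory.
Import numFieldNormedType.Exports.

Set Implicit Arguments.
Unset Strict Implicit.
Unset Printing Implicit Defensive.

Local Open Scope classical_set_scope.
Local Open Scope ring_scope.

(** * Finite linear combinations, their projections and transports *)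

Section linear_span.
Context {R : realType}.
Implicit Types (A B : set (R -> R)) (f g : R -> R).

Lemma sub_lspan A : A `<=` lspan A.
Proof.
move=> f Af; exists 1%N, (fun=> 1), (fun=> f); split => //.
by apply/funext => x; rewrite big_ord1 mul1r.
Qed.

Lemma lspan0 A : lspan A (cst 0).
Proof.
exists 0%N, (fun=> 0), (fun=> cst 0); split; first by case.
by apply/funext => x; rewrite big_ord0.
Qed.

Lemma lspanD A f g : lspan A f -> lspan A g -> lspan A (f \+ g).
Proof.
move=> [m [c [h [Ah ->]]]] [m' [c' [h' [Ah' ->]]]].
exists (m + m')%N,
  (fun i => match fintype.split i with inl j => c j | inr j => c' j end),
  (fun i => match fintype.split i with inl j => h j | inr j => h' j end); split.
  by move=> i; case: fintype.split.
apply/funext => x /=; rewrite big_split_ord /=; congr (_ + _);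
  apply: eq_bigr => i _.
  by rewrite (unsplitK (inl i)).
by rewrite (unsplitK (inr i)).
Qed.

Lemma lspanZ A k f : lspan A f -> lspan A (fun x => k * f x).
Proof.
move=> [m [c [h [Ah ->]]]]; exists m, (fun i => k * c i), h; split => //.
by apply/funext => x; rewrite mulr_sumr; apply: eq_bigr => i _; rewrite mulrA.
Qed.

Lemma lspanB A f g : lspan A f -> lspan A g -> lspan A (f \- g).
Proof.
move=> Af Ag; rewrite [X in lspan _ X](_ : _ = f \+ (fun x => -1 * g x)).
  exact/lspanD/lspanZ.
by apply/funext => x /=; rewrite mulN1r.
Qed.

Lemma lspan_sum A m (c : 'I_m -> R) (h : 'I_m -> R -> R) :
  (forall i, lspan A (h i)) -> lspan A (fun x => \sum_(i < m) c i * h i x).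
Proof.
elim: m => [|m IHm] in c h * => Ah.
  by under eq_fun do rewrite big_ord0; exact: lspan0.
under eq_fun do rewrite big_ord_recl.
by apply: lspanD; [exact: lspanZ | exact: IHm].
Qed.

Lemma lspan_sub A B : A `<=` lspan B -> lspan A `<=` lspan B.
Proof. by move=> AB f [m [c [h [Ah ->]]]]; apply: lspan_sum => i; exact: AB. Qed.

(** An element chosen by [xget] is in the span by its specification, and the default [cst 0] is the
    empty combination. *)
Lemma proj01_lspan A f : lspan A (proj01 A f).
Proof. by rewrite /proj01; case: xgetP => [g _ [] //|_]; exact: lspan0. Qed.

Lemma transport_lspan (a : set R) x A f :
  lspan A f -> lspan (transport a x @` A) (transport a x f).
Proof.
move=> [m [c [h [Ah ->]]]]; exists m, c, (fun i => transport a x (h i)).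
by split=> [i|//]; exists (h i).
Qed.

Lemma L2closure_sub (J : set R) A B :
  A `<=` B -> L2closure J A `<=` L2closure J B.
Proof. by move=> AB f [Jf fA]; split=> // e /fA[g /AB]; exists g. Qed.

End linear_span.

(** * Comparison of the reference generators of two levels *)

Section nested_generators.
Context {R : realType}.
Implicit Type n : nat.

(** [zfun n] involves only [phi n.+1] and [phi (n + 3)]: positivity of [n] makes the first index at
    least 2, and [n + 3 <= m] bounds the second. *)
Lemma inner_gens_le n m : (0 < n)%N -> (n + 3 <= m)%N ->
  @inner_gens R n `<=` lspan (inner_gens m).
Proof.
move=> n0 nm.
have phim i : (2 <= i <= m)%N -> lspan (@inner_gens R m) (phi i).
  by move=> im; apply: sub_lspan; right; exists i.
move=> _ [->|[i /= /andP[i2 ni] <-]].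
  apply: lspanD; first apply: lspanZ; apply: phim.
    by rewrite ltnS n0 (leq_trans _ nm)// addn3 ltnS leqW.
  by rewrite nm andbT addn3.
by apply: phim; rewrite i2 (leq_trans ni)// (leq_trans _ nm)// leq_addr.
Qed.

(** The ramp cancels, leaving two projections, each in a span contained in that of
    [inner_gens m]. *)
Lemma lfun_diff n m : (0 < n)%N -> (n + 3 <= m)%N ->
  lspan (@inner_gens R m) (lfun n \- lfun m).
Proof.
move=> n0 nm; rewrite [X in lspan _ X](_ : _ =
    proj01 (inner_gens m) ramp_l \- proj01 (inner_gens n) ramp_l).
  apply: lspanB; first exact: proj01_lspan.
  exact: lspan_sub (inner_gens_le n0 nm) _ (proj01_lspan _ _).
by apply/funext => x /=; rewrite /lfun /=; ring.
Qed.

Lemma rfun_diff n m : (0 < n)%N -> (n + 3 <= m)%N ->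
  lspan (@inner_gens R m) (rfun n \- rfun m).
Proof.
move=> n0 nm; rewrite [X in lspan _ X](_ : _ =
    proj01 (inner_gens m) ramp_r \- proj01 (inner_gens n) ramp_r).
  apply: lspanB; first exact: proj01_lspan.
  exact: lspan_sub (inner_gens_le n0 nm) _ (proj01_lspan _ _).
by apply/funext => x /=; rewrite /rfun /=; ring.
Qed.

End nested_generators.

(** * Order structure of the knots, and inclusion between levels *)

Section knots.
Context {R : realType}.
Implicit Types (J a : set R) (x : R).

(** Working with an abstract total relation lets one induction yield both least and greatest
    knots. *)
Lemma finite_extremum (T : eqType) (r : rel T) (A : set T) :
  total r -> transitive r -> finite_set A -> A !=set0 ->
  exists2 m, A m & forall w, A w -> r w m.
Proof.
move=> tot tr /finite_seqP[s ->] [x /= xs].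
elim: s x xs => // y s IHs x _.
case: s IHs => [_|z s IHs].
  exists y => /= [|w]; first by rewrite inE.
  by rewrite inE => /eqP ->; case/orP: (tot y y).
have [m ms mmax] := IHs z (mem_head _ _).
case/orP: (tot y m) => ym.
  exists m => [/=|w /=]; first by rewrite inE ms orbT.
  by rewrite inE => /predU1P[->//|/mmax].
exists y => [/=|w /=]; first by rewrite inE eqxx.
by rewrite inE => /predU1P[->|/mmax /tr]; [case/orP: (tot y y)|apply].
Qed.

(** Bolzano-Weierstrass: infinitely many knots in [[u, v]] would have a limit point there, hence in
    [J] because [J] is an interval. *)
Lemma finite_knots J a u v : is_interval J -> knot_sequence J a ->
  J u -> J v -> finite_set (a `&` `[u, v]).
Proof.
move=> itvJ [aJ _ nolim _ _] Ju Jv; apply: contrapT => inf.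
have bnd : bounded_set (a `&` `[u, v]).
  exists (`|u| + `|v|); split; first exact: num_real.
  move=> M uvM y [_ /=]; rewrite in_itv /= => /andP[uy yv].
  rewrite ler_norml; apply/andP; split.
    by have := ler_norm (- u); rewrite normrN; have := normr_ge0 v; lra.
  by have := ler_norm v; have := normr_ge0 u; lra.
have [l ll] := infinite_bounded_limit_point_nonempty inf bnd.
have luv : l \in `[u, v].
  have : closure `[u, v] l.
    apply: closureS (subset_limit_point ll); exact: subIsetr.
  by rewrite -(closure_id _).1//; exact: interval_closed.
have Jl : J l by move: luv; rewrite in_itv/=; exact: itvJ.
apply: (nolim l Jl) => U /ll[y [yl [ay _] Uy]]; by exists y.
Qed.

Lemma knot_above J a x : knot_sequence J a -> (x%:E < esup J)%E ->
  exists2 w, a w & x < w.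
Proof.
move=> [_ _ _ _ <-] /ereal_sup_gt[_ [w aw <-]]; rewrite lte_fin => xw.
by exists w.
Qed.

Lemma knot_below J a x : knot_sequence J a -> (einf J < x%:E)%E ->
  exists2 w, a w & w < x.
Proof.
move=> [_ _ _ <- _] /ereal_inf_lt[_ [w aw <-]]; rewrite lte_fin => xw.
by exists w.
Qed.

(** Since [a] and [J] have the same supremum, some knot [w] exceeds [x]; the successor is the least
    of the finitely many knots in []x, w]]. *)
Lemma knot_succP J a x : is_interval J -> knot_sequence J a ->
  J x -> (x%:E < esup J)%E ->
  exists s, [/\ knot_succ a x = s%:E, a s, x < s &
    forall w, a w -> x < w -> s <= w].
Proof.
move=> itvJ ka Jx xs; have aJ : a `<=` J by case: ka.
have [w aw xw] := knot_above ka xs.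
have fin : finite_set (a `&` `]x, w]).
  apply: sub_finite_set (finite_knots itvJ ka Jx (aJ _ aw)).
  by apply: setIS => y /=; rewrite !in_itv/= => /andP[/ltW -> ->].
have ne : a `&` `]x, w] !=set0 by exists w; split => //=; rewrite in_itv/= xw lexx.
have [] := @finite_extremum _ (fun p q : R => q <= p) _ _ _ fin ne.
- by move=> p q; exact: le_total.
- by move=> p q r /= pq rp; exact: le_trans rp pq.
move=> s [as_ /=]; rewrite in_itv/= => /andP[xs' sw] smin.
have sP y : a y -> x < y -> s <= y.
  move=> ay xy; case: (leP y w) => [yw|/ltW wy]; last exact: le_trans wy.
  by apply: smin; split => //=; rewrite in_itv/= xy.
exists s; split => //; rewrite /knot_succ; case: xgetP => [_ -> [y [ay xy yP] <-]|].
  by congr EFin; apply/le_anti; rewrite yP// sP.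
by move=> /(_ s%:E) []; exists s.
Qed.

Lemma knot_predP J a x : is_interval J -> knot_sequence J a ->
  J x -> (einf J < x%:E)%E ->
  exists s, [/\ knot_pred a x = s%:E, a s, s < x &
    forall w, a w -> w < x -> w <= s].
Proof.
move=> itvJ ka Jx xs; have aJ : a `<=` J by case: ka.
have [w aw xw] := knot_below ka xs.
have fin : finite_set (a `&` `[w, x[).
  apply: sub_finite_set (finite_knots itvJ ka (aJ _ aw) Jx).
  by apply: setIS => y /=; rewrite !in_itv/= => /andP[-> /ltW ->].
have ne : a `&` `[w, x[ !=set0 by exists w; split => //=; rewrite in_itv/= xw lexx.
have [] := @finite_extremum _ (fun p q : R => p <= q) _ _ _ fin ne.
- by move=> p q; exact: le_total.
- by move=> p q r; exact: le_trans.
move=> s [as_ /=]; rewrite in_itv/= => /andP[sw xs'] smax.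
have sP y : a y -> y < x -> y <= s.
  move=> ay xy; case: (leP w y) => [yw|/ltW wy]; last exact: (le_trans wy).
  by apply: smax; split => //=; rewrite in_itv/= xy yw.
exists s; split => //; rewrite /knot_pred; case: xgetP => [_ -> [y [ay xy yP] <-]|].
  by congr EFin; apply/le_anti; rewrite yP// sP.
by move=> /(_ s%:E) []; exists s.
Qed.

(** The cell starts at the last knot not exceeding [t]. Its description through comparisons with all
    knots names neither endpoint, so any two points of one cell yield the same set; this lets
    rationals index the cells. *)
Lemma knot_cell J a t : is_interval J -> knot_sequence J a ->
  (einf J < t%:E)%E -> (t%:E < esup J)%E ->
  exists x s, [/\ a x, (x%:E < esup J)%E, knot_succ a x = s%:E, x <= t < s &
    `[x, s[%classic = [set y | forall w, a w -> (w <= y) = (w <= t)] ].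
Proof.
move=> itvJ ka it ts; have aJ : a `<=` J by case: ka.
have [w aw wt] := knot_below ka it.
have [u au tu] := knot_above ka ts.
have Jt : J t.
  by apply: (itvJ w u); [exact: aJ | exact: aJ | rewrite (ltW wt) (ltW tu)].
have [] := @finite_extremum _ (fun p q : R => p <= q) _ _ _
    (finite_knots itvJ ka (aJ _ aw) Jt).
- by move=> p q; exact: le_total.
- by move=> p q r; exact: le_trans.
- by exists w; split => //=; rewrite in_itv/= lexx ltW.
move=> x [ax /=]; rewrite in_itv/= => /andP[wx xt] xmax.
have xs : (x%:E < esup J)%E by rewrite (le_lt_trans _ ts)// lee_fin.
have [s [xsE as_ xs' smin]] := knot_succP itvJ ka (aJ _ ax) xs.
have {xmax} ts' : t < s.
  rewrite ltNge; apply/negP => st; suff : s <= x by rewrite leNgt xs'.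
  by apply: xmax; split => //=; rewrite in_itv/= st (le_trans wx (ltW xs')).
exists x, s; split => //; first by rewrite xt.
apply/seteqP; split => y /=; rewrite in_itv/=.
  move=> /andP[xy ys] v av; have [vx|xv] := leP v x.
    by rewrite (le_trans vx xy) (le_trans vx xt).
  have sv := smin _ av xv.
  by rewrite !leNgt (lt_le_trans ys sv) (lt_le_trans ts' sv).
by move=> yt; rewrite yt// xt ltNge yt// -ltNge.
Qed.

(** Every branch of [Omega_breve] contains the transported [inner_gens n], whether or not the cell
    touches an end of [J]. *)
Lemma transport_inner_Omega J a n x f : a x -> (x%:E < esup J)%E ->
  lspan (inner_gens n) f -> lspan (Omega J a n) (transport a x f).
Proof.
move=> ax xs /(transport_lspan a x); apply: lspan_sub => g gx.
apply: sub_lspan; left; exists x => //; rewrite /Omega_breve.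
by case: ifP => _; [right|case: ifP => _; [right|]].
Qed.

Lemma Omega_sub J a n m : is_interval J -> knot_sequence J a ->
  (0 < n)%N -> (n + 3 <= m)%N -> Omega J a n `<=` lspan (Omega J a m).
Proof.
move=> itvJ ka n0 nm; have aJ : a `<=` J by case: ka.
(* Trading a boundary function of level [n] for that of level [m] costs only inner generators on the
   same cell. *)
have shift x f g : a x -> (x%:E < esup J)%E ->
    lspan (inner_gens m) (f \- g) -> lspan (Omega J a m) (transport a x g) ->
    lspan (Omega J a m) (transport a x f).
  move=> ax xs fg gx; rewrite [X in lspan _ X](_ : _ =
    transport a x (f \- g) \+ transport a x g).
    exact/lspanD/gx/transport_inner_Omega.
  by apply/funext => t; rewrite /transport /= subrK.
have common x g : a x -> (x%:E < esup J)%E ->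
    (transport a x @` inner_gens n) g -> lspan (Omega J a m) g.
  move=> ax xs [f fn <-]; apply: transport_inner_Omega => //.
  exact: (inner_gens_le n0 nm).
move=> f [[x [ax xs]]|[x [ax /andP[ix xs]] ->]].
  rewrite /Omega_breve; case: ifPn => xi.
    move=> [->|]; last exact: common.
    apply: (shift _ _ (lfun m)) => //; first exact: lfun_diff.
    apply: sub_lspan; left; exists x => //.
    by rewrite /Omega_breve xi; left.
  case: ifPn => sx; last exact: common.
  move=> [->|]; last exact: common.
  apply: (shift _ _ (rfun m)) => //; first exact: rfun_diff.
  apply: sub_lspan; left; exists x => //.
  by rewrite /Omega_breve (negbTE xi) sx; left.
have [p [pE ap px _]] := knot_predP itvJ ka (aJ _ ax) ix.
have ps : (p%:E < esup J)%E by rewrite (lt_trans _ xs)// lte_fin.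
(* The corrections on the two cells meeting at [x] are separate elements of the span; what remains
   is the generator of level [m] at [x]. *)
rewrite pE /= [X in lspan _ X](_ : _ = (transport a p (rfun n \- rfun m) \+
    transport a x (lfun n \- lfun m)) \+
    (transport a p (rfun m) \+ transport a x (lfun m))); last first.
  by apply/funext => t; rewrite /transport /=; ring.
apply: lspanD; first apply: lspanD.
- by apply: transport_inner_Omega => //; exact: rfun_diff.
- by apply: transport_inner_Omega => //; exact: lfun_diff.
apply: sub_lspan; right; exists x; rewrite /= ?ix//.
by rewrite /Omega_bar pE.
Qed.

End knots.

(** * Closure in L^2: linearity and limits *)

Section L2_closure.
Context {R : realType}.
Local Notation mu := (@lebesgue_measure R).
Implicit Types (J : set R) (A : set (R -> R)) (f g : R -> R).

Lemma restrictD J f g : (f \+ g) \_ J = f \_ J \+ g \_ J.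
Proof. by apply/funext => x; rewrite /= !patchE; case: ifP; rewrite ?addr0. Qed.

Lemma restrictZ J k f : (fun x => k * f x) \_ J = k \*: (f \_ J).
Proof. by apply/funext => x; rewrite /= !patchE; case: ifP; rewrite ?scaler0. Qed.

Lemma L2_measurable J f : L2 J f -> measurable_fun [set: R] (f \_ J).
Proof. by case/andP; rewrite inE. Qed.

Lemma L2norm_lty J f : L2 J f -> (L2norm J f < +oo)%E.
Proof. by case/andP => _; rewrite inE. Qed.

Lemma L2P J f : L2 J f <-> measurable_fun [set: R] (f \_ J) /\ (L2norm J f < +oo)%E.
Proof.
split=> [Jf|[mf Nf]]; first by split; [exact: L2_measurable | exact: L2norm_lty].
by apply/andP; split; rewrite inE.
Qed.

Lemma L2D J f g : L2 J f -> L2 J g -> L2 J (f \+ g).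
Proof.
rewrite /L2/= restrictD => Jf Jg.
exact: (Lfun_addr_closed mu (lee1n 2)).2.
Qed.

Lemma L2Z J k f : L2 J f -> L2 J (fun x => k * f x).
Proof.
rewrite /L2/= [in X in _ -> X](_ : (fun x => k * f x) \_ J = k \o* (f \_ J)).
  exact/Lfun_scale/ler1n.
by apply/funext => x; rewrite restrictZ /= mulrC.
Qed.

Lemma L2B J f g : L2 J f -> L2 J g -> L2 J (f \- g).
Proof.
move=> Jf Jg; rewrite [X in L2 _ X](_ : _ = f \+ (fun x => -1 * g x)).
  exact/L2D/L2Z.
by apply/funext => x /=; rewrite mulN1r.
Qed.

Lemma L2_cst0 J : L2 J (cst 0).
Proof.
rewrite /L2/= [X in X \in _](_ : _ = cst 0).
  apply/andP; split; rewrite inE; [exact: measurable_cst|].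
  exact: finite_norm_cst0 (lee1n 2).
by apply/funext => x; rewrite /= patchE; case: ifP.
Qed.

Lemma lspan_L2 J A : A `<=` L2 J -> lspan A `<=` L2 J.
Proof.
move=> AJ f [m [c [h [Ah ->]]]] {f}.
elim: m => [|m IHm] in c h Ah *.
  by under eq_fun do rewrite big_ord0; exact: L2_cst0.
under eq_fun do rewrite big_ord_recl.
by apply: L2D; [apply/L2Z/AJ | apply: IHm].
Qed.

Lemma L2norm_pow2 J f : (L2norm J f `^ 2 = \int[mu]_x ((f \_ J) x ^+ 2)%:E)%E.
Proof.
rewrite /L2norm poweR_Lnorm//; apply: eq_integral => x _ /=.
by rewrite powR_mulrn// real_normK ?num_real.
Qed.

Lemma L2norm_lt J f (e : R) : 0 < e ->
  (\int[mu]_x ((f \_ J) x ^+ 2)%:E < (e ^+ 2)%:E)%E -> (L2norm J f < e%:E)%E.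
Proof.
move=> e0; rewrite -L2norm_pow2 !ltNge; apply: contra => eN.
rewrite -powR_mulrn ?(ltW e0)// -poweR_EFin gt0_ler_poweR//.
  by rewrite in_itv/= leey andbT lee_fin ltW.
by rewrite in_itv/= leey andbT Lnorm_ge0.
Qed.

Lemma L2normD J f g : L2 J f -> L2 J g ->
  (L2norm J (f \+ g)%R <= L2norm J f + L2norm J g)%E.
Proof.
move=> /L2_measurable mf /L2_measurable mg.
rewrite /L2norm restrictD; apply: eminkowski => //; exact: (lee1n 2).
Qed.

Lemma L2normZ J k f : L2 J f ->
  (L2norm J (fun x => k * f x)%R = `|k|%:E * L2norm J f)%E.
Proof.
move=> Jf; rewrite /L2norm restrictZ.
exact: (LnormZ (Lfun_Sub (lee1n 2) Jf) k).
Qed.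

Lemma le_L2 J f g : measurable_fun [set: R] (f \_ J) -> L2 J g ->
  (forall x, J x -> `|f x| <= `|g x|) -> L2 J f.
Proof.
move=> mf /L2P[mg Ng] fg; apply/L2P; split => //.
apply: (@lty_poweRy _ _ 2) => //.
apply: le_lt_trans (poweR_lty 2 Ng).
rewrite !L2norm_pow2; apply: ge0_le_integral => //.
- by move=> x _; rewrite lee_fin sqr_ge0.
- by apply/measurable_EFinP; exact: measurable_funX.
- by apply/measurable_EFinP; exact: measurable_funX.
move=> x _; rewrite lee_fin !patchE; case: ifP => // /set_mem Jx.
rewrite -(real_normK (num_real (f x))) -(real_normK (num_real (g x))).
by rewrite lerXn2r ?nnegrE ?fg.
Qed.

Lemma L2_norm J f : L2 J f -> L2 J (Num.norm \o f).
Proof.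
move=> Jf; apply: (le_L2 _ Jf) => [|x _]; last by rewrite /= normr_id.
rewrite [X in measurable_fun _ X](_ : _ = Num.norm \o (f \_ J)).
  by apply: measurableT_comp => //; exact: L2_measurable.
by apply/funext => x; rewrite /= !patchE; case: ifP => //; rewrite normr0.
Qed.

Lemma indic_restrict_sub J (B : set R) : B `<=` J -> (\1_B : R -> R) \_ J = \1_B.
Proof.
move=> BJ; apply/funext => x; rewrite patchE; case: ifPn => // xJ.
by rewrite indicE memNset// => /BJ /mem_set; rewrite (negbTE xJ).
Qed.

Lemma L2_indic J (C : set R) : measurable C -> C `<=` J -> (mu C < +oo)%E ->
  L2 J \1_C.
Proof.
move=> mC CJ Cfin.
have CE := indic_restrict_sub CJ.
apply/L2P; split; first by rewrite CE.
apply: (@lty_poweRy _ _ 2) => //; rewrite L2norm_pow2 CE.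
rewrite (_ : \int[mu]_x _ = \int[mu]_x (\1_C x)%:E)%E.
  by rewrite integral_indic ?setIT.
apply: eq_integral => x _; rewrite indicE.
by case: (x \in C); rewrite ?expr1n ?expr0n.
Qed.

Lemma mem_L2closure J A f : L2 J f -> A f -> L2closure J A f.
Proof.
move=> Jf Af; split=> // e e0; exists f => //.
rewrite /L2norm [X in Lnorm _ _ X](_ : _ = cst 0%E) ?Lnorm0//.
by apply/funext => x; rewrite /= patchE; case: ifP; rewrite /= ?subrr.
Qed.

(** Idempotence of the closure: two approximations within [e / 2] combine by Minkowski's
    inequality. *)
Lemma L2closure_cvg J A f : A `<=` L2 J -> L2 J f ->
  (forall e : R, 0 < e ->
     exists2 g, L2closure J A g & (L2norm J (f \- g)%R < e%:E)%E) ->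
  L2closure J A f.
Proof.
move=> AJ Jf fA; split => // e e0.
have e2 : 0 < e / 2 by rewrite divr_gt0.
have [g [Jg gA] fg] := fA _ e2.
have [h Ah gh] := gA _ e2; exists h => //.
rewrite [X in L2norm _ X](_ : _ = (f \- g) \+ (g \- h)).
  apply: (le_lt_trans (L2normD _ _)); [exact: L2B|exact/L2B/AJ|].
  by rewrite [e]splitr EFinD lteD.
by apply/funext => x /=; rewrite addrA subrK.
Qed.

Lemma L2closureD J A f g : A `<=` L2 J ->
  L2closure J (lspan A) f -> L2closure J (lspan A) g ->
  L2closure J (lspan A) (f \+ g).
Proof.
move=> AJ [Jf fA] [Jg gA]; have lAJ := lspan_L2 AJ.
split=> [|e e0]; first exact: L2D.
have e2 : 0 < e / 2 by rewrite divr_gt0.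
have [h Ah fh] := fA _ e2; have [k Ak gk] := gA _ e2.
exists (h \+ k); first exact: lspanD.
rewrite [X in L2norm _ X](_ : _ = (f \- h) \+ (g \- k)).
  apply: (le_lt_trans (L2normD _ _)); [exact/L2B/lAJ|exact/L2B/lAJ|].
  by rewrite [e]splitr EFinD lteD.
by apply/funext => x /=; rewrite opprD addrACA.
Qed.

Lemma L2closureZ J A k f : A `<=` L2 J ->
  L2closure J (lspan A) f -> L2closure J (lspan A) (fun x => k * f x).
Proof.
move=> AJ [Jf fA]; have lAJ := lspan_L2 AJ.
split=> [|e e0]; first exact: L2Z.
(* The summand 1 keeps the tolerance positive when [k] is 0. *)
have [h Ah fh] := fA (e / (`|k| + 1)) (divr_gt0 e0 (ltr_wpDl (normr_ge0 _) ltr01)).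
exists (fun x => k * h x); first exact: lspanZ.
rewrite [X in L2norm _ X](_ : _ = (fun x => k * (f \- h) x)).
  rewrite L2normZ; last exact/L2B/lAJ.
  have : (`|k|%:E * L2norm J (f \- h)%R <= `|k|%:E * (e / (`|k| + 1))%:E)%E.
    by apply: lee_wpmul2l; [rewrite lee_fin | exact: ltW].
  move=> /le_lt_trans; apply; rewrite -EFinM lte_fin mulrCA gtr_pMr//.
  by rewrite ltr_pdivrMr ?mul1r ?ltrDl// ltr_wpDl.
by apply/funext => x /=; rewrite mulrBr.
Qed.

Lemma L2closureB J A f g : A `<=` L2 J ->
  L2closure J (lspan A) f -> L2closure J (lspan A) g ->
  L2closure J (lspan A) (f \- g).
Proof.
move=> AJ Jf Jg; rewrite [X in L2closure _ _ X](_ : _ = f \+ (fun x => -1 * g x)).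
  exact/L2closureD/L2closureZ.
by apply/funext => x /=; rewrite mulN1r.
Qed.

Lemma L2closure_sum J A m (c : 'I_m -> R) (h : 'I_m -> R -> R) : A `<=` L2 J ->
  (forall i, L2closure J (lspan A) (h i)) ->
  L2closure J (lspan A) (fun x => \sum_(i < m) c i * h i x).
Proof.
move=> AJ; elim: m => [|m IHm] in c h * => Ah.
  under eq_fun do rewrite big_ord0.
  exact: mem_L2closure (L2_cst0 J) (lspan0 A).
under eq_fun do rewrite big_ord_recl.
by apply: L2closureD => //; [exact: L2closureZ | exact: IHm].
Qed.

(** Dominated convergence for the squares of [f - f_ n], which are bounded by the integrable
    [4 g ^ 2]. Each later limit in L^2 is taken through this lemma. *)
Lemma L2closure_dominated J A (f_ : nat -> R -> R) f g : A `<=` L2 J ->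
  (forall n, L2closure J A (f_ n)) -> measurable_fun [set: R] (f \_ J) ->
  L2 J g -> (forall n x, J x -> `|f_ n x| <= g x) ->
  (forall x, J x -> `|f x| <= g x) ->
  {ae mu, forall x, J x -> f_ ^~ x @ \oo --> f x} ->
  L2closure J A f.
Proof.
move=> AJ f_A mf Jg f_g fg f_f; have Jf : L2 J f.
  by apply: le_L2 mf Jg _ => x Jx; rewrite (le_trans (fg x Jx))// ler_norm.
apply: L2closure_cvg => // e e0.
pose h n x := ((f \- f_ n) \_ J) x ^+ 2.
have mh n : measurable_fun [set: R] (EFin \o h n).
  apply/measurable_EFinP; apply: measurable_funX.
  by apply: L2_measurable; apply: L2B => //; exact: (f_A n).1.
have Ig : mu.-integrable [set: R] (EFin \o (fun x => 2 ^+ 2 * (g \_ J) x ^+ 2)).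
  rewrite [X in _.-integrable _ X](_ : _ =
    EFin \o (fun x => ((fun x => 2 * g x) \_ J) x ^+ 2)).
    exact/Lfun2_integrable_sqr/L2Z.
  by apply/funext => x /=; rewrite restrictZ/= exprMn.
have [||_ h0 _] := @dominated_convergence _ _ _ mu _ measurableT
    (fun n => EFin \o h n) (cst 0%E) _ mh (measurable_cst _) _ Ig.
- move: f_f; apply: filterS; first exact: (ae_filter_ringOfSetsType mu).
  move=> x fx _; apply/cvg_EFin; first exact: nearW.
  rewrite /h/=; case: (boolP (x \in J)) => [/set_mem Jx|xJ].
    under [X in X @ _]eq_fun do rewrite /= patchE mem_set//.
    have c0 : f x - f_ n x @[n --> \oo] --> 0.
      by rewrite -(subrr (f x)); apply: cvgB; [exact: cvg_cst | exact: fx].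
    have := @cvgM _ _ _ eventually_filter _ _ _ _ c0 c0; rewrite mulr0; exact.
  under [X in X @ _]eq_fun do rewrite /= patchE (negbTE xJ) expr0n.
  exact: cvg_cst.
- apply: aeW => x n _ /=; rewrite lee_fin /h !patchE.
  case: ifPn => [/set_mem Jx|_]; last by rewrite !expr0n mulr0 normr0.
  rewrite ger0_norm ?sqr_ge0// -exprMn -[leLHS]real_normK ?num_real//.
  have g0 : 0 <= g x by exact: le_trans (fg x Jx).
  rewrite lerXn2r ?nnegrE ?mulr_ge0//= (le_trans (ler_normB _ _))//.
  by rewrite mulr2n mulrDl mul1r lerD ?fg ?f_g.
move: h0 => /fine_cvgP[fin /cvgr_lt /(_ (e ^+ 2))].
move=> /(_ (exprn_gt0 _ e0)) lt.
(* One index must give both finiteness and smallness, because [fine] sends infinite values to 0. *)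
have [n [finn ltn]] : exists n,
    (\int[mu]_x `|(EFin \o h n) x - cst 0%E x| \is a fin_num)%E /\
    fine (\int[mu]_x `|(EFin \o h n) x - cst 0%E x|)%E < e ^+ 2.
  by near \oo => n; exists n; split; near: n.
exists (f_ n) => //; apply: L2norm_lt => //.
rewrite (_ : \int[mu]_x _ = \int[mu]_x `|(EFin \o h n) x - cst 0%E x|)%E.
  by rewrite -(fineK finn) lte_fin.
by apply: eq_integral => x _ /=; rewrite subr0 ger0_norm ?sqr_ge0.
Unshelve. all: by end_near. Qed.

End L2_closure.

Import HBSimple HBNNSimple.

(** * From intervals to measurable sets, then to functions supported in [C] *)

Section indicators.
Context {R : realType}.
Local Notation mu := (@lebesgue_measure R).
Variables (J : set R) (A : set (R -> R)) (C : set R).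
Hypotheses (mJ : measurable J) (AJ : A `<=` L2 J).
Hypotheses (mC : measurable C) (CJ : C `<=` J).
Local Notation clA := (L2closure J (lspan A)).

Lemma measurable_restrictS (D : set R) (h : R -> R) : measurable D ->
  measurable_fun [set: R] h -> measurable_fun [set: R] (h \_ D).
Proof. 
move=> mD mh; have [+ _] := measurable_restrictT h mD; apply.
exact: measurable_funTS.
 Qed.

(** The half-open intervals form a pi-system generating the measurable sets, and [H] is a
    lambda-system: proper differences come from linearity, increasing unions from dominated
    convergence with bound [\1_C], which is in L^2 as [C] has finite measure. *)
Lemma L2closure_measurable_indic : (mu C < +oo)%E ->
  (forall p q, clA \1_(`]p, q] `&` C)) -> clA \1_C ->
  forall B, measurable B -> clA \1_(B `&` C).
Proof.
move=> Cfin AI AC.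
have L2C := L2_indic mC CJ Cfin.
pose H := [set B : set R | measurable B /\ clA \1_(B `&` C)].
suff HH : measurable `<=` H by move=> B /HH[].
apply: lambda_system_subset => //.
- exact: ocitvI.
- split=> //.
  + by split => //; rewrite setTI.
  + move=> X Y YX [mX AX] [mY AY]; split; first exact: measurableD.
    rewrite (_ : \1_ _ = (\1_(X `&` C) \- \1_(Y `&` C) : R -> R)).
      exact: L2closureB.
    apply/funext => x /=; rewrite !indicE setDE !in_setI in_setC.
    have : x \in Y -> x \in X by move=> /set_mem/YX/mem_set.
    case: (x \in X) (x \in Y) (x \in C) => [] [] []; rewrite /= ?subr0 ?subrr//.
    by move=> /(_ isT).
  + move=> F ndF HF; split; first by apply: bigcup_measurable => n _; case: (HF n).
    have mF : measurable (\bigcup_n F n).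
      by apply: bigcup_measurable => n _; case: (HF n).
    apply: (@L2closure_dominated _ _ _ (fun n => \1_(F n `&` C)) _ \1_C).
    * exact: lspan_L2.
    * by move=> n; case: (HF n).
    * rewrite indic_restrict_sub; first exact/measurable_indic/measurableI.
      by apply: subset_trans CJ; exact: subIsetr.
    * exact: L2C.
    * move=> n x _; rewrite !indicE in_setI ger0_norm// ler_nat.
      by case: (_ \in _); case: (_ \in _).
    * move=> x _; rewrite !indicE in_setI ger0_norm// ler_nat.
      by case: (_ \in _); case: (_ \in _).
    * apply: aeW => x Jx; apply: cvg_near_cst.
      have [[n _ Fnx]|nF] := pselect ((\bigcup_n F n) x).
        exists n => // m /= nm.
        rewrite !indicE !in_setI; congr (_ (_ && _))%:R.
        rewrite !mem_set//; first by exists n.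
        by have /subsetPset := ndF _ _ nm; apply.
      apply: nearW => n; rewrite !indicE !in_setI; congr (_ (_ && _))%:R.
      by rewrite !memNset// => Fnx; apply: nF; exists n.
- move=> _ [[p q] _ <-]; split; last exact: AI.
  exact: measurable_itv.
Qed.

(** Simple functions increase to [p], which itself serves as the dominating function. *)
Lemma L2closure_nonneg (p : R -> R) : (forall B, measurable B -> clA \1_(B `&` C)) ->
  measurable_fun [set: R] p -> L2 J p -> (forall x, 0 <= p x) ->
  (forall x, ~ C x -> p x = 0) -> clA p.
Proof.
move=> AB mp L2p p0 pC.
have mEp : measurable_fun [set: R] (EFin \o p) by exact/measurable_EFinP.
have Ep0 x : [set: R] x -> (0 <= (EFin \o p) x)%E by rewrite lee_fin.
pose g n := nnsfun_approx measurableT mEp n.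
have gp n x : g n x <= p x.
  by rewrite /g nnsfun_approxE -lee_fin; exact: le_approx.
apply: (@L2closure_dominated _ _ _ (fun n => g n) _ p) => //.
- exact: lspan_L2.
- move=> n; rewrite (funext (fimfunEord (g n))).
  set s := finmap.enum_fset _; rewrite (_ : (fun x => _) =
    (fun x => \sum_(i < size s) s`_i * \1_((g n @^-1` [set s`_i]) `&` C) x)).
    by apply: L2closure_sum => // i; exact: AB.
  apply/funext => x; apply: eq_bigr => i _; rewrite !indicE in_setI.
  have [/set_mem/= gx|] := boolP (x \in g n @^-1` [set _]); last by rewrite mulr0.
  (* Cutting the level sets down to [C] is harmless: off [C] the simple function is squeezed between
     0 and [p x = 0], so the level value is 0. *)
  have [//|/negP xC] := boolP (x \in C).
  rewrite -gx (_ : g n x = 0) ?mul0r//.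
  by apply/le_anti; rewrite fun_ge0 andbT -(pC x) ?gp// => /mem_set.
- exact: measurable_restrictS.
- by move=> n x _; rewrite ger0_norm ?fun_ge0.
- by move=> x _; rewrite ger0_norm.
apply: aeW => x _; have := cvg_nnsfun_approx measurableT mEp Ep0 (x := x) I.
by move=> /fine_cvgP[_].
Qed.

Lemma L2closure_restrict : (forall B, measurable B -> clA \1_(B `&` C)) ->
  forall f, L2 J f -> clA (f \_ C).
Proof.
move=> AB f Jf.
have fC : (f \_ J) \_ C = f \_ C.
  apply/funext => x; rewrite !patchE; case: ifPn => // /set_mem/CJ xJ.
  by rewrite mem_set.
have mfC : measurable_fun [set: R] (f \_ C).
  by rewrite -fC; apply: measurable_restrictS => //; exact: L2_measurable.
(* Handles the positive and the negative part of [f \_ C] at once, with [h] equal to [f \_ C] or to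
   its opposite. *)
have pos (h : R -> R) : measurable_fun [set: R] h ->
    (forall x, h x = f \_ C x \/ h x = - f \_ C x) ->
    clA (h \max cst 0).
  move=> mh hE; have mh0 : measurable_fun [set: R] (h \max cst 0).
    exact: measurable_maxr.
  apply: L2closure_nonneg => //.
  - apply: (le_L2 _ Jf); first exact: measurable_restrictS.
    move=> x Jx; rewrite ger0_norm ?le_max ?lexx ?orbT//= ge_max normr_ge0 andbT.
    by case: (hE x) => ->; rewrite patchE; case: ifP => _;
      rewrite ?oppr0 ?normr_ge0 ?ler_norm// -normrN ler_norm.
  - by move=> x /=; rewrite le_max lexx orbT.
  - by move=> x xC /=; case: (hE x) => ->; rewrite patchE memNset// ?oppr0 maxxx.
rewrite (_ : f \_ C = ((f \_ C) \max cst 0) \- ((\- (f \_ C)) \max cst 0)).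
  apply: L2closureB => //; apply: pos => //; [by left| |by right].
  exact: measurableT_comp.
apply/funext => x /=; case: (ltP (f \_ C x) 0) => fx.
  by rewrite max_l ?oppr_ge0 1?ltW// sub0r opprK.
by rewrite max_r ?subr0// oppr_le0.
Qed.

End indicators.

(** * Bernstein polynomials of indicators *)

Section bernstein.
Context {R : realType}.
Implicit Types (f g : nat -> R) (x d : R) (E : set R).

(* The Bernstein polynomial \sum_(k < n.+1) f k 'C(n, k) X^k (1 - X)^(n - k), in
   de Casteljau form. *)
Fixpoint bernstein n f : {poly R} :=
  if n is n'.+1 then
    'X * bernstein n' (f \o S) + (1 - 'X) * bernstein n' f
  else (f 0%N)%:P.

Lemma bernsteinS n f x : (bernstein n.+1 f).[x] =
  x * (bernstein n (f \o S)).[x] + (1 - x) * (bernstein n f).[x].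
Proof. by rewrite /= !hornerE. Qed.

Lemma bernstein_at0 n f : (bernstein n f).[0] = f 0%N.
Proof.
elim: n f => [f|n IHn f]; first by rewrite hornerC.
by rewrite bernsteinS IHn mul0r add0r subr0 mul1r.
Qed.

Lemma bernstein_at1 n f : (bernstein n f).[1] = f n.
Proof.
elim: n f => [f|n IHn f]; first by rewrite hornerC.
by rewrite bernsteinS !IHn subrr mul0r addr0 mul1r.
Qed.

Lemma le_bernstein n f g x : 0 <= x <= 1 -> (forall k, f k <= g k) ->
  (bernstein n f).[x] <= (bernstein n g).[x].
Proof.
move=> /andP[x0 x1]; elim: n f g => [f g fg|n IHn f g fg].
  by rewrite !hornerC.
rewrite !bernsteinS lerD// ler_wpM2l ?subr_ge0//; apply: IHn => // k.
exact: fg.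
Qed.

(** The operator is linear and reproduces constants, as the de Casteljau weights [x] and [1 - x] sum
    to 1. *)
Lemma bernstein_affine n a b f x :
  (bernstein n (fun k => a + b * f k)).[x] = a + b * (bernstein n f).[x].
Proof.
elim: n f => [f|n IHn f]; first by rewrite !hornerC.
rewrite !bernsteinS IHn [X in x * X](_ : _ = a + b * (bernstein n (f \o S)).[x]).
  by ring.
exact: IHn (f \o S).
Qed.

(** Second moment about [c] of a binomial variable with parameters [n] and [x]: variance plus
    squared bias. *)
Lemma bernstein_sqr n c x : (bernstein n (fun k => (k%:R - c) ^+ 2)).[x] =
  n%:R * (x * (1 - x)) + (n%:R * x - c) ^+ 2.
Proof.
elim: n c => [c|n IHn c]; first by rewrite hornerC mulr0n !mul0r !add0r.
rewrite bernsteinS IHn.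
(* Composition with [S] moves the centre from [c] to [c - 1]. *)
rewrite [X in x * X](_ : _ = n%:R * (x * (1 - x)) + (n%:R * x - (c - 1)) ^+ 2).
  by rewrite -natr1; ring.
rewrite -IHn; congr (_.[_]); congr bernstein; apply/funext => k /=.
by rewrite -natr1; congr (_ ^+ 2); ring.
Qed.

Definition bernstein_indic n E := bernstein n (fun k => \1_E (k%:R / n%:R)).

Lemma bernstein_indic_01 n E x : 0 <= x <= 1 -> 0 <= (bernstein_indic n E).[x] <= 1.
Proof.
move=> x01; have cst c : (bernstein n (fun=> c)).[x] = c.
  by have := bernstein_affine n c 0 (fun=> 0) x; rewrite !mul0r !addr0.
apply/andP; split.
  by rewrite -[leLHS]cst; apply: le_bernstein.
by rewrite -[leRHS]cst; apply: le_bernstein.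
Qed.

(* Chebyshev: where [k / n] is close to [x] the two indicators agree, and
   elsewhere their difference is at most [((k / n - x) / d) ^+ 2]. *)
Lemma bernstein_indic_dist n E x d : (0 < n)%N -> 0 <= x <= 1 -> 0 < d ->
  (forall y, `|y - x| < d -> \1_E y = \1_E x :> R) ->
  `|\1_E x - (bernstein_indic n E).[x]| <= (n%:R * d ^+ 2)^-1.
Proof.
move=> n0 x01 d0 Ex.
have n0R : 0 < n%:R :> R by rewrite ltr0n.
pose g k := (k%:R - n%:R * x) ^+ 2 : R.
pose b := ((n%:R * d) ^+ 2)^-1.
(* The bias vanishes at the centre [n * x], and [x * (1 - x) <= 1] bounds the variance. *)
have bg : b * (bernstein n g).[x] <= (n%:R * d ^+ 2)^-1.
  rewrite bernstein_sqr subrr expr0n addr0.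
  have -> : b * (n%:R * (x * (1 - x))) = (x * (1 - x)) * (n%:R * d ^+ 2)^-1.
    by rewrite /b; field; rewrite !gt_eqF.
  apply: ler_piMl; first by rewrite invr_ge0 mulr_ge0 ?sqr_ge0 ?ltW.
  by move: x01 => /andP[? ?]; nra.
have dist k : `|\1_E (k%:R / n%:R) - \1_E x| <= b * g k.
  have [close|far] := ltP `|k%:R / n%:R - x| d.
    by rewrite Ex// subrr normr0 mulr_ge0 ?sqr_ge0// invr_ge0 sqr_ge0.
  apply: (@le_trans _ _ 1).
    by rewrite !indicE; case: (_ \in _) (_ \in _) => [] [];
       rewrite ?subrr ?subr0 ?sub0r ?normrN ?normr0 ?normr1.
  rewrite /b mulrC ler_pdivlMr ?exprn_gt0 ?mulr_gt0// mul1r.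
  rewrite -[g k]real_normK ?num_real// lerXn2r ?nnegrE ?mulr_ge0 ?(ltW d0)//.
  have -> : k%:R - n%:R * x = n%:R * (k%:R / n%:R - x).
    by field; rewrite gt_eqF.
  by rewrite normrM gtr0_norm// ler_wpM2l.
(* Each bound compares the node values with [\1_E x] minus or plus [b * g k], whose Bernstein
   polynomial is given by [bernstein_affine]. *)
rewrite distrC ler_norml; apply/andP; split.
  rewrite lerBrDl; apply: (@le_trans _ _ (\1_E x + (- b) * (bernstein n g).[x])).
    by rewrite lerD2l mulNr lerN2.
  rewrite -bernstein_affine; apply: le_bernstein => // k.
  by have := dist k; rewrite ler_norml => /andP[+ _]; rewrite mulNr; lra.
rewrite lerBlDl; apply: (@le_trans _ _ (\1_E x + b * (bernstein n g).[x])).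
  rewrite -bernstein_affine; apply: le_bernstein => // k.
  by have := dist k; rewrite ler_norml => /andP[_]; lra.
by rewrite lerD2l.
Qed.

Lemma cvg_bernstein_indic E x d : 0 <= x <= 1 -> 0 < d ->
  (forall y, `|y - x| < d -> \1_E y = \1_E x :> R) ->
  (bernstein_indic n E).[x] @[n --> \oo] --> (\1_E x : R).
Proof.
move=> x01 d0 Ex; apply/cvgrPdist_le => e e0.
(* From this threshold on, [(n * d ^ 2)^-1] is at most [e]. *)
exists (Num.truncn (e * d ^+ 2)^-1).+1 => // n /= en.
have n0 : (0 < n)%N by exact: leq_trans en.
have ed0 : 0 < e * d ^+ 2 by rewrite mulr_gt0 ?exprn_gt0.
apply: le_trans (bernstein_indic_dist n0 x01 d0 Ex) _.
have : (e * d ^+ 2)^-1 <= n%:R.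
  by apply: ltW; apply: lt_le_trans (truncnS_gt _) _; rewrite ler_nat.
rewrite -div1r ler_pdivrMr// => en1.
by rewrite -div1r ler_pdivrMr ?mulr_gt0 ?ltr0n ?exprn_gt0// mulrCA.
Qed.

End bernstein.

(** * Bubbles on a single cell *)

Section bubbles.
Context {R : realType}.
Local Notation mu := (@lebesgue_measure R).
Local Notation chi := (\1_(`[0, 1[%classic) : R -> R).
Implicit Types (p q w : {poly R}).

(** Holds in either case of [xget]: the default ['X^i] is also monic of size [i.+1]. *)
Lemma ultraspherical_monic i :
  @ultraspherical R i \is monic /\ size (@ultraspherical R i) = i.+1.
Proof.
rewrite /ultraspherical; case: xgetP => [p _ []//|_].
by rewrite monicXn size_polyXn.
Qed.

(** Triangularity: subtracting the top coefficient times a monic polynomial of the same degree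
    lowers the size. *)
Lemma ultraspherical_span n w : (size w <= n)%N ->
  exists c : 'I_n -> R, w = \sum_(i < n) c i *: ultraspherical i.
Proof.
elim: n w => [w|n IHn w wn].
  by rewrite leqn0 size_poly_eq0 => /eqP ->; exists (fun=> 0); rewrite big_ord0.
have [/monicP U1 Usz] := ultraspherical_monic n.
have [|c wE] := IHn (w - w`_n *: ultraspherical n).
  apply/leq_sizeP => j; rewrite leq_eqVlt coefB coefZ => /predU1P[<-|nj].
    by move: U1; rewrite /lead_coef Usz => /= ->; rewrite mulr1 subrr.
  rewrite (nth_default 0 (leq_trans wn nj)).
  by rewrite [(ultraspherical n)`_j]nth_default ?Usz// mulr0 subrr.
exists (fun i => if unlift ord_max i is Some j then c j else w`_n).
rewrite big_ord_recr /= unlift_none -[LHS](subrK (w`_n *: ultraspherical n)) wE.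
congr (_ + _); apply: eq_bigr => i _.
have -> : widen_ord (leqnSn n) i = lift ord_max i.
  by apply/val_inj; rewrite /= /bump leqNgt ltn_ord.
by rewrite liftK.
Qed.

(** Such a [q] is divisible by [x * (1 - x)], and the quotient, rewritten in the variable
    [2 * x - 1], expands in ultraspherical polynomials. *)
Lemma bubble_lspan q : q.[0] = 0 -> q.[1] = 0 ->
  lspan (phi @` [set i | (2 <= i)%N]) (fun x => q.[x] * chi x).
Proof.
move=> /rootP /factor_theorem[r qE] q1.
have /factor_theorem[s rE] : root r 1.
  by apply/rootP; move: q1; rewrite qE hornerM hornerXsubC subr0 mulr1.
(* Chosen so that [w] at [2 * x - 1] is [- s] at [x]; the sign turns the factor [x - 1] into
   [1 - x]. *)
pose w := (- s) \Po (2^-1 *: ('X + 1)).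
have [c wE] := ultraspherical_span (leqnn (size w)).
exists (size w), c, (fun i => phi (i + 2)); split.
  by move=> i; exists (i + 2)%N => //=; rewrite addn2.
apply/funext => x.
have -> : q.[x] = x * (1 - x) * w.[2 * x - 1].
  rewrite qE rE /w horner_comp !hornerE.
  rewrite (_ : 2^-1 * (2 * x - 1 + 1) = x); last by field.
  ring.
have -> : w.[2 * x - 1] = \sum_i c i * (ultraspherical i).[2 * x - 1].
  by rewrite {1}wE horner_sum; apply: eq_bigr => i _; rewrite hornerZ.
rewrite mulr_sumr mulr_suml; apply: eq_bigr => i _.
by rewrite /phi addnK; ring.
Qed.

Lemma phi_poly i : exists p, phi i = (fun x => p.[x] * chi x).
Proof.
exists ('X * (1 - 'X) * (ultraspherical (i - 2) \Po (2 *: 'X - 1))).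
by apply/funext => x; rewrite /phi hornerM horner_comp !hornerE.
Qed.

Lemma poly_bounded01 p : exists M, forall x, 0 <= x <= 1 -> `|p.[x]| <= M.
Proof.
elim/poly_ind: p => [|p c [M pM]].
  by exists 0 => x _; rewrite horner0 normr0.
exists (M + `|c|) => x x01; rewrite hornerMXaddC (le_trans (ler_normD _ _))// lerD2r.
rewrite normrM (le_trans _ (pM x x01))// ler_piMr//.
by move: x01 => /andP[x0 x1]; rewrite ger0_norm.
Qed.

Variables (J : set R) (u s : R).
Hypotheses (us : u < s) (uJ : `[u, s[ `<=` J).
Local Notation scale t := ((t - u) / (s - u)).

Lemma chi_scale t : chi (scale t) = \1_(`[u, s[) t.
Proof.
rewrite !indicE; congr (_ (_ : bool))%:R; apply/idP/idP => /set_mem/=;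
  rewrite in_itv/= => /andP[h0 h1]; apply/mem_set; rewrite /= in_itv/=.
  move: h0 h1; rewrite ler_pdivlMr ?subr_gt0// ltr_pdivrMr ?subr_gt0// mul0r mul1r.
  by rewrite subr_ge0 => ->; rewrite ltrD2r.
rewrite ler_pdivlMr ?subr_gt0// ltr_pdivrMr ?subr_gt0// mul0r mul1r.
by rewrite subr_ge0 h0 ltrD2r.
Qed.

Let mC : measurable (`[u, s[ : set R) := measurable_itv _.

Let Cfin : (mu `[u, s[ < +oo)%E.
Proof.
by rewrite lebesgue_measure_itv/=; case: ifP => // _; rewrite -EFinB ltry.
Qed.

Lemma transported_poly_L2 p : L2 J (fun t => p.[scale t] * chi (scale t)).
Proof.
have [M pM] := poly_bounded01 p.
have mg : measurable_fun [set: R] (fun t : R => p.[scale t] * \1_(`[u, s[) t).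
  apply: measurable_funM; last exact: measurable_indic.
  apply: (@measurableT_comp _ _ _ _ _ _ (horner p)).
    exact: measurable_poly.
  by apply: measurable_funM => //; exact: measurable_funB.
under eq_fun do rewrite chi_scale.
apply: (@le_L2 _ _ _ (fun t => M * \1_(`[u, s[) t)).
- rewrite (_ : _ \_ _ = (fun t : R => p.[scale t] * \1_(`[u, s[) t))//.
  apply/funext => t; rewrite patchE; case: ifPn => // tJ.
  by rewrite indicE memNset ?mulr0// => /uJ/mem_set; rewrite (negbTE tJ).
- exact/L2Z/L2_indic.
move=> t _; rewrite !normrM -chi_scale indicE.
have [/set_mem/=|] := boolP (_ \in _); last by rewrite normr0 !mulr0.
rewrite in_itv/= => /andP[x0 x1]; rewrite normr1 !mulr1.
by rewrite (le_trans (pM _ _)) ?ler_norm// x0 ltW.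
Qed.

Variable A : set (R -> R).
Hypothesis AJ : A `<=` L2 J.
Hypothesis Abubble : forall q, q.[0] = 0 -> q.[1] = 0 ->
  lspan A (fun t => q.[scale t] * chi (scale t)).
Local Notation clA := (L2closure J (lspan A)).

(** Bernstein polynomials of the interval pulled back to the unit interval are bubbles bounded by 1,
    and they converge almost everywhere on the cell. *)
Lemma L2closure_itv_indic a b : clA \1_(`]a, b] `&` `[u, s[).
Proof.
(* Requiring [0 < y < 1] makes the Bernstein polynomials of [E] vanish at both endpoints. *)
pose E := [set y : R | (a < u + (s - u) * y <= b) && (0 < y < 1)].
have su0 : 0 < s - u by rewrite subr_gt0.
pose q n := bernstein_indic n E.
have E0 : \1_E (0 : R) = 0 :> R.
  by rewrite indicE memNset//=; rewrite /E /= ltxx andbF.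
have E1 : \1_E (1 : R) = 0 :> R.
  by rewrite indicE memNset//=; rewrite /E /= ltxx !andbF.
have q0 n : (q n).[0] = 0 by rewrite bernstein_at0 mul0r.
have q1 n : (q n).[1] = 0.
  (* For [n = 0] the last node is [0 / 0], which is 0 by convention, so [E0] applies instead of
     [E1]. *)
  rewrite bernstein_at1; case: n => [|n]; first by rewrite mul0r.
  by rewrite divff ?pnatr_eq0.
have mI : measurable (`]a, b] `&` `[u, s[ : set R) by exact: measurableI.
apply: (@L2closure_dominated _ _ _ 
  (fun n t => (q n).[scale t] * chi (scale t)) _ \1_(`[u, s[)).
- exact: lspan_L2.
- move=> n; have Aq := Abubble (q0 n) (q1 n).
  exact: mem_L2closure (lspan_L2 AJ Aq) Aq.
- rewrite indic_restrict_sub; first exact: measurable_indic.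
  by apply: subset_trans uJ; exact: subIsetr.
- exact: L2_indic.
- move=> n t _; rewrite chi_scale normrM [`|\1__ _|]ger0_norm//.
  rewrite -chi_scale indicE.
  have [/set_mem/=|] := boolP (_ \in _); last by rewrite !mulr0.
  rewrite in_itv/= !mulr1 => /andP[x0 x1].
  have /andP[? ?] : 0 <= (q n).[scale t] <= 1.
    by apply: bernstein_indic_01; rewrite x0 ltW.
  by rewrite ger0_norm.
- move=> t _; rewrite !indicE in_setI ger0_norm// ler_nat.
  by case: (_ \in _); case: (_ \in _).
(* At [u] the approximants are 0 although [u] may belong to the interval; at [a] and [b] the
   indicator may jump. *)
exists [set u; a; b]; split.
- by apply: measurableU => //; apply: measurableU => //; exact: measurable_set1.
- by apply: countable_lebesgue_measure0; apply: finite_set_countable.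
move=> t; apply: contra_notP => tuab Jt.
have [|tC] := boolP (t \in `[u, s[); last first.
  have C0 : \1_(`[u, s[) t = 0 :> R by rewrite indicE memNset//=; exact/negP.
  under [X in X @ _]eq_fun do rewrite chi_scale C0 mulr0.
  rewrite indicE memNset; first exact: cvg_cst.
  by move=> [_ /=]; exact/negP.
rewrite in_itv/= le_eqVlt => /andP[/predU1P[tu|ut] ts].
  by exfalso; apply: tuab; left; left; rewrite tu.
have ta : 0 < `|t - a|.
  by rewrite normr_gt0 subr_eq0; apply/eqP => ta; apply: tuab; left; right.
have tb : 0 < `|t - b|.
  by rewrite normr_gt0 subr_eq0; apply/eqP => tb; apply: tuab; right.
have tC : \1_(`[u, s[) t = 1 :> R by rewrite indicE mem_set//= in_itv/= ts ltW.
under [X in X @ _]eq_fun do rewrite chi_scale tC mulr1.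
have scaleK : u + (s - u) * scale t = t by rewrite mulrC divfK ?subrKC// gt_eqF.
have scale01 : 0 < scale t < 1.
  by rewrite divr_gt0 ?subr_gt0//= ltr_pdivrMr// mul1r ltrD2r.
have -> : \1_(`]a, b] `&` `[u, s[) t = \1_E (scale t) :> R.
  rewrite !indicE in_setI; congr (_ (_ : bool))%:R.
  rewrite [X in _ && X]mem_set ?andbT; last by rewrite /= in_itv/= ts ltW.
  apply/idP/idP => /set_mem/= tE; apply/mem_set.
    by move: tE; rewrite /E/= scaleK scale01 in_itv/= => ->.
  by move: tE; rewrite /E/= scaleK in_itv/= => /andP[].
(* Within distance [m] of [t] no point crosses [a], [b], [u] or [s], so membership in [E] is
   constant on the rescaled neighbourhood. *)
pose m := Num.min (Num.min `|t - a| `|t - b|) (Num.min (t - u) (s - t)).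
have m0 : 0 < m by rewrite !lt_min ta tb !subr_gt0 ut ts.
apply: (@cvg_bernstein_indic _ _ _ (m / (s - u))).
- by move: scale01 => /andP[/ltW -> /ltW ->].
- by rewrite divr_gt0.
move=> y ym; rewrite !indicE; congr (_ (_ : bool))%:R.
pose t' := u + (s - u) * y.
have : `|t' - t| < m.
  rewrite -[t in X in X < _]scaleK /t' opprD addrACA subrr add0r.
  rewrite -mulrBr normrM gtr0_norm//.
  by rewrite mulrC -ltr_pdivlMr.
rewrite !lt_min => /andP[/andP[t'a t'b] /andP[t'u t's]].
have y01 : 0 < y < 1.
  have y0 : 0 < (s - u) * y by move: t'u; rewrite ltr_norml /t' => /andP[? ?]; lra.
  have y1 : (s - u) * y < (s - u) * 1.
    by move: t's; rewrite ltr_norml /t' => /andP[? ?]; lra.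
  by move: y0 y1; rewrite pmulr_rgt0// ltr_pM2l// => -> ->.
have aE : (a < t') = (a < t).
  move: t'a; rewrite ltr_norml => /andP[].
  case: (ltrP 0 (t - a)) => h; [rewrite gtr0_norm//|rewrite ler0_norm//] => h1 h2.
    have -> : a < t by lra.
    by lra.
  have -> : (a < t) = false by apply/negbTE; rewrite -leNgt; lra.
  by apply/negbTE; rewrite -leNgt; lra.
have bE : (t' <= b) = (t <= b).
  move: t'b; rewrite ltr_norml => /andP[].
  case: (ltrP 0 (t - b)) => h; [rewrite gtr0_norm//|rewrite ler0_norm//] => h1 h2.
    have -> : (t <= b) = false by apply/negbTE; rewrite -ltNge; lra.
    by apply/negbTE; rewrite -ltNge; lra.
  have -> : t <= b by lra.
  by lra.
apply/idP/idP => /set_mem/= tE; apply/mem_set; move: tE;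
  by rewrite /E/= scaleK -/t' aE bE y01 scale01.
Qed.

End bubbles.

(** * Density of the bubbles of all cells *)

Section density.
Context {R : realType}.
Local Notation mu := (@lebesgue_measure R).
Variables (J a : set R).
Hypotheses (itvJ : is_interval J) (ka : knot_sequence J a).

Let aJ : a `<=` J.
Proof. by case: ka. Qed.

(** Tied to no level: density is shown for the span of this set, then passed on to the union of the
    levels. *)
Definition bubbles : set (R -> R) := [set g | exists x i,
  [/\ a x, (x%:E < esup J)%E, (2 <= i)%N & g = transport a x (phi i)]].

(** A combination involves finitely many bubbles, and the largest of their degrees is a level from
    which all are available. *)
Lemma bubbles_Omega f : lspan bubbles f ->
  exists N, forall n, (N <= n)%N -> lspan (Omega J a n) f.
Proof.
move=> [m [c [h [Ah ->]]]] {f}.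
have {Ah} hN i : exists N, forall n, (N <= n)%N -> lspan (Omega J a n) (h i).
  have [x [k [ax xs k2 ->]]] := Ah i; exists k => n kn.
  apply: transport_inner_Omega => //; apply: sub_lspan; right; exists k => //=.
  by rewrite k2.
have [N Nh] := choice hN; exists (\max_i N i)%N => n Nn.
by apply: lspan_sum => i; apply: Nh; apply: leq_trans Nn; exact: leq_bigmax.
Qed.

Lemma cell_sub x s : a x -> (x%:E < esup J)%E -> knot_succ a x = s%:E ->
  x < s /\ `[x, s[ `<=` J.
Proof.
move=> ax xs; have [s' [-> as' xs' _]] := knot_succP itvJ ka (aJ ax) xs.
move=> [<-]; split => // y /=; rewrite in_itv/= => /andP[xy ys].
by apply: (itvJ (aJ ax) (aJ as')); rewrite xy ltW.
Qed.

Lemma bubbles_L2 : bubbles `<=` L2 J.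
Proof.
move=> _ [x [i [ax xs _ ->]]].
have [s [sE _ _ _]] := knot_succP itvJ ka (aJ ax) xs.
have [xs' sJ] := cell_sub ax xs sE; have [p ->] := @phi_poly R i.
by rewrite /transport sE; exact: transported_poly_L2.
Qed.

Local Notation clA := (L2closure J (lspan bubbles)).

Lemma L2closure_cell x s f : a x -> (x%:E < esup J)%E -> knot_succ a x = s%:E ->
  L2 J f -> clA (f \_ `[x, s[).
Proof.
move=> ax xs sE; have [xs' sJ] := cell_sub ax xs sE.
have itv_indic p q : clA \1_(`]p, q] `&` `[x, s[).
  apply: (L2closure_itv_indic xs' sJ bubbles_L2).
  move=> r r0 r1; have := bubble_lspan r0 r1.
  move=> /(transport_lspan a x); rewrite /transport sE/=; apply: lspan_sub.
  move=> _ [_ [i /= i2 <-] <-]; apply: sub_lspan; exists x, i.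
  by rewrite /transport sE.
have mJ := is_interval_measurable itvJ.
apply: (L2closure_restrict mJ bubbles_L2) => //.
apply: (L2closure_measurable_indic bubbles_L2) => //.
  by rewrite lebesgue_measure_itv/=; case: ifP => // _; rewrite -EFinB ltry.
(* The cell has the form treated by [itv_indic]; starting at [x - 1] makes the left-open interval
   contain [x]. *)
rewrite (_ : `[x, s[%classic = `]x - 1, s] `&` `[x, s[)//.
apply/esym/setIidPr => y /=.
rewrite !in_itv/= => /andP[xy ys]; rewrite (ltW ys) andbT.
by rewrite (lt_le_trans _ xy)// ltrBlDr ltrDl.
Qed.

(* The cell of a point [t], described by the knots on its left. *)
Let cell t := if ((einf J < t%:E) && (t%:E < esup J))%E then
  [set y | forall w, a w -> (w <= y) = (w <= t)] else set0.

Let cl_cell t f : L2 J f -> clA (f \_ (cell t)).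
Proof.
move=> Jf; rewrite /cell; case: ifPn => [/andP[it ts]|_].
  have [x [s [ax xs sE _ <-]]] := knot_cell itvJ ka it ts.
  exact: L2closure_cell.
rewrite patch_set0; exact: mem_L2closure (L2_cst0 J) (lspan0 _).
Qed.

(** [f] is the limit of its restrictions to finite unions of cells, dominated by its absolute
    value. *)
Lemma L2_bubbles : L2 J `<=` clA.
Proof.
move=> f Jf.
(* Every cell contains a rational, so enumerating the rationals enumerates the cells, with
   repetitions. *)
pose F n := if @unpickle rat n is Some q then cell (ratr q) else set0.
pose U n := \big[setU/set0]_(i < n) F i.
have clF n g : L2 J g -> clA (g \_ (F n)).
  move=> Jg; rewrite /F; case: unpickle => [q|]; first exact: cl_cell.
  rewrite patch_set0; exact: mem_L2closure (L2_cst0 J) (lspan0 _).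
have clU n : clA (f \_ (U n)).
  elim: n => [|n IHn].
    rewrite /U big_ord0 patch_set0; exact: mem_L2closure (L2_cst0 J) (lspan0 _).
  (* [F n] may repeat an earlier cell, so only the remainder of [f] off [U n] is restricted to
     it. *)
  rewrite [X in clA X](_ : _ = f \_ (U n) \+ (f \- f \_ (U n)) \_ (F n)).
    apply: L2closureD => //; first exact: bubbles_L2.
    by apply: clF; apply: L2B => //; exact: IHn.1.
  apply/funext => t; rewrite /= !patchE.
  have -> : (t \in U n.+1) = (t \in U n) || (t \in F n).
    by rewrite /U big_ord_recr/= in_setU.
  rewrite /= patchE; case: (t \in U n); case: (t \in F n) => /=;
    by rewrite ?subrr ?subr0 ?addr0 ?add0r.
apply: (@L2closure_dominated _ _ _ (fun n => f \_ (U n)) _ (Num.norm \o f)).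
- exact/lspan_L2/bubbles_L2.
- exact: clU.
- exact: L2_measurable.
- exact: L2_norm.
- by move=> n t _ /=; rewrite patchE; case: ifP; rewrite ?normr0.
- by [].
(* Only finite endpoints of [J] can be missed; for an infinite end [fine] gives 0, which merely
   enlarges the null set. *)
exists [set fine (einf J); fine (esup J)]; split.
- by apply: measurableU; exact: measurable_set1.
- by apply: countable_lebesgue_measure0; apply: finite_set_countable.
move=> t; apply: contra_notP => tJ Jt.
have it : (einf J < t%:E)%E.
  rewrite lt_neqAle; apply/andP; split.
    by apply/eqP => tE; apply: tJ; left; rewrite tE.
  by apply: ereal_inf_lbound; exists t.
have ts : (t%:E < esup J)%E.
  rewrite lt_neqAle; apply/andP; split.
    by apply/eqP => tE; apply: tJ; right; rewrite -tE.
  by apply: ereal_sup_ubound; exists t.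
have [x [s [ax xs sE /andP[xt ts'] cE]]] := knot_cell itvJ ka it ts.
(* A rational between [t] and [s] has the same knots on its left as [t], hence the same [cell]. *)
have [q] := rat_in_itvoo ts'; rewrite in_itv/= => /andP[tq qs].
have as_ : a s.
  by have [s' [+ ? _ _]] := knot_succP itvJ ka (aJ ax) xs; rewrite sE => -[->].
have cqt : cell (ratr q) t.
  rewrite /cell (lt_trans it) ?lte_fin//=.
  rewrite (lt_le_trans (y := s%:E)) ?lte_fin//; last first.
    by apply: ereal_sup_ubound; exists s => //; exact: aJ.
  move=> w aw; have : `[x, s[%classic (ratr q : R).
    by rewrite /= in_itv/= qs (le_trans xt (ltW tq)).
  by rewrite cE/= => /(_ w aw) ->.
have [k Fk] : exists k, F k t by exists (pickle q); rewrite /F pickleK.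
apply: cvg_near_cst; exists k.+1 => // n /= kn.
by rewrite patchE mem_set// /U -bigcup_mkord; exists k.
Qed.

End density.

Theorem proposition4 (R : realType) (J a : set R) (kappa : nat) :
  is_interval J -> knot_sequence J a -> (1 <= kappa <= 3)%N ->
  let V := fun k : nat => closed_span J (Omega J a (3 * k + kappa)%N) in
  (forall k : nat, V k `<=` V k.+1) /\ L2dense J (\bigcup_k V k).
Proof.
move=> itvJ ka /andP[k0 _] V; split=> [k|f Jf].
  (* Consecutive values of [3 * k + kappa] differ by exactly 3, the gap that [Omega_sub]
     requires. *)
  apply/L2closure_sub/lspan_sub/Omega_sub => //; first by rewrite addn_gt0 k0 orbT.
  by rewrite mulnS addnC addnA.
have [_ fA] := L2_bubbles itvJ ka Jf; split=> // e /fA[g Ag fg]; exists g => //.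
(* The threshold [N] can itself be the index [k], since [N <= 3 * N + kappa]; the approximant then
   lies in [V N]. *)
have [N gN] := bubbles_Omega Ag; exists N => //.
apply: mem_L2closure; first exact: lspan_L2 (bubbles_L2 itvJ ka) _ Ag.
by apply: gN; rewrite mulSn -addnA leq_addr.
Qed.
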